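(* Let $t$ be a closed term. If $d\colon t\to_{\mathrm{cbv}}^{*} s$ with $\mathrm{normal}_{\mathrm{cbv}}(s)$, then there is a tight derivation in the CbV type system of $\vdash^{(|d|_m,|d|_e)} t:\mathbf 0$.
   Context: Terms: $t,s ::= x \mid \lambda x.t \mid t\,s \mid t[x\leftarrow s]$, where $t[x\leftarrow s]$ (explicit substitution) binds $x$ in $t$; values $v ::= \lambda x.t$. $\mathrm{fv}(t[x\leftarrow s])=(\mathrm{fv}(t)\setminus\{x\})\cup\mathrm{fv}(s)$; closed means no free variables; terms up to $\alpha$-equivalence. Contexts: CbV (= weak) contexts $V ::= \langle\cdot\rangle \mid V t \mid V[x\leftarrow t] \mid t V \mid t[x\leftarrow V]$; substitution contexts $S ::= \langle\cdot\rangle \mid S[x\leftarrow t]$; $V\langle t\rangle$ plugging (may capture), $V\langle\langle t\rangle\rangle$ plugging where $V$ does not capture free variables of $t$. Root steps: $S\langle\lambda x.t\rangle s\mapsto_m S\langle t[x\leftarrow s]\rangle$ (variables bound by $S$ disjoint from $\mathrm{fv}(s)$); $V\langle\langle x\rangle\rangle[x\leftarrow S\langle v\rangle]\mapsto_e S\langle V\langle\langle v\rangle\rangle[x\leftarrow v]\rangle$ (variables bound by $S$ disjoint from $\mathrm{fv}(V\langle\langle x\rangle\rangle)$). $\to_{m,\mathrm{cbv}}$ (resp. $\to_{e,\mathrm{cbv}}$) relates $V\langle t'\rangle$ to $V\langle s'\rangle$ for any CbV context $V$ when $t'\mapsto_m s'$ (resp. $\mapsto_e$); $\to_{\mathrm{cbv}}$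 is their union. $|d|_m,|d|_e$ count multiplicative and exponential steps of $d$. $\mathrm{normal}_{\mathrm{cbv}}$: least predicate with $\mathrm{normal}_{\mathrm{cbv}}(\lambda x.t)$ and ($\mathrm{normal}_{\mathrm{cbv}}(t)$ and $\mathrm{normal}_{\mathrm{cbv}}(s)$) $\Rightarrow\mathrm{normal}_{\mathrm{cbv}}(t[x\leftarrow s])$. CbV types: linear types $L ::= M\to N$; multi types $M,N ::= [L_i]_{i\in J}$ finite multisets, $\mathbf 0$ empty multiset, $\uplus$ union. Type contexts $\Gamma$ map variables to multi types, all but finitely many to $\mathbf 0$; $\mathrm{dom}(\Gamma)=\{x\mid\Gamma(x)\ne\mathbf 0\}$; empty if domain empty; $\uplus$ pointwise; $\Gamma,x:M$ means $\Gamma\uplus(x\mapsto M)$ with $x\notin\mathrm{dom}(\Gamma)$. Rules: (ax) $x:M\vdash^{(0,1)} x:M$ for any multi type $M$; (app) from $\Gamma\vdash^{(m,e)} t:[M\to N]$ and $\Pi\vdash^{(m',e')} s:M$ infer $\Gamma\uplus\Pi\vdash^{(m+m'+1,e+e')} t\,s:N$; (fun) from $\Gamma,x:N\vdash^{(m,e)} t:M$ infer $\Gamma\vdash^{(m,e)}\lambda x.t:N\to M$; (many) from $\Pi_i\vdash^{(m_i,e_i)}\lambda x.t:L_i$ for $i\in J$ ($J$ finite, possibly empty) infer $\biguplus_i\Pi_i\vdash^{(\sum m_i,\sum e_i)}\lambda x.t:[L_i]_{i\in J}$; (ES) from $\Gamma,x:N\vdash^{(m,e)} t:M$ and $\Pi\vdash^{(m',e')}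 s:N$ infer $\Gamma\uplus\Pi\vdash^{(m+m',e+e')} t[x\leftarrow s]:M$. A derivation of $\Gamma\vdash^{(m,e)} t:M$ is tight if $M=\mathbf 0$ and $\Gamma$ is empty. *)

(* Defs.v *)
From HB Require Import structures.
From mathcomp Require Import all_boot finmap multiset.

Set Implicit Arguments.
Unset Strict Implicit.
Unset Printing Implicit Defensive.

Local Open Scope nat_scope.

(* Terms up to alpha-equivalence are encoded with de Bruijn indices: [Lam t]
   is \x.t and [ES t s] is t[x<-s]; both bind index 0 in [t] (and not in [s]). *)
Inductive term : Type :=
| Var of nat
| Lam of term
| App of term & term
| ES of term & term.

Fixpoint free (x : nat) (t : term) : bool :=
  match t with
  | Var y => x == y
  | Lam t => free x.+1 t
  | App t s => free x t || free x s
  | ES t s => free x.+1 t || free x s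
  end.

Definition closed_term (t : term) : Prop := forall x, ~~ free x t.

(* [shift d c t] adds [d] to the free indices of [t] that are at least [c]. *)
Fixpoint shift (d c : nat) (t : term) : term :=
  match t with
  | Var x => Var (if c <= x then d + x else x)
  | Lam t => Lam (shift d c.+1 t)
  | App t s => App (shift d c t) (shift d c s)
  | ES t s => ES (shift d c.+1 t) (shift d c s)
  end.

(* [AppL V t] is V t, [AppR t V] is t V, [ESL V t] is V[x<-t] and [ESR t V] is
   t[x<-V]. *)
Inductive cctx : Type :=
| Hole
| AppL of cctx & term
| ESL of cctx & term
| AppR of term & cctx
| ESR of term & cctx.

Fixpoint sub_ctx (V : cctx) : bool :=
  match V with
  | Hole => true
  | ESL V _ => sub_ctx V
  | _ => false
  end.

(* V<t>: plugging that may capture, i.e. the indices of [t] are read in the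
   scope of the hole. *)
Fixpoint plug (V : cctx) (t : term) : term :=
  match V with
  | Hole => t
  | AppL V s => App (plug V t) s
  | ESL V s => ES (plug V t) s
  | AppR s V => App s (plug V t)
  | ESR s V => ES s (plug V t)
  end.

(* The number of binders of [V] whose scope contains the hole. *)
Fixpoint depth (V : cctx) : nat :=
  match V with
  | Hole => 0
  | AppL V _ | AppR _ V | ESR _ V => depth V
  | ESL V _ => (depth V).+1
  end.

(* V<<t>>: plugging without capture, i.e. the indices of [t] are read in the
   scope of the root of [V]. *)
Definition plug_nc (V : cctx) (t : term) : term := plug V (shift (depth V) 0 t).

Fixpoint shift_ctx (d c : nat) (V : cctx) : cctx :=
  match V with
  | Hole => Hole
  | AppL V t => AppL (shift_ctx d c V) (shift d c t)
  | ESL V t => ESL (shift_ctx d c.+1 V) (shift d c t)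
  | AppR t V => AppR (shift d c t) (shift_ctx d c V)
  | ESR t V => ESR (shift d c.+1 t) (shift_ctx d c V)
  end.

(* The argument [s] enters the scope of the binders of [S]; shifting it is the
   de Bruijn form of the requirement that these binders do not occur free in
   it. *)
Inductive root_m : term -> term -> Prop :=
| RootM S t s : sub_ctx S ->
    root_m (App (plug S (Lam t)) s) (plug S (ES t (shift (depth S) 0 s))).

(* On the left-hand side [V] is in the scope of x (index 0), and [Lam u] is in
   the scope of [S]. On the right-hand side [V] has moved into the scope of
   [S], which leaves x unchanged (whence the cutoff 1), and the copy of [Lam u]
   plugged into [V] has moved into the scope of x (whence the shift by 1). *)
Inductive root_e : term -> term -> Prop :=
| RootE V S u : sub_ctx S ->
    root_e (ES (plug_nc V (Var 0)) (plug S (Lam u)))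
           (plug S (ES (plug_nc (shift_ctx (depth S) 1 V) (shift 1 0 (Lam u)))
                       (Lam u))).

Inductive step_m : term -> term -> Prop :=
| StepM V t s : root_m t s -> step_m (plug V t) (plug V s).

Inductive step_e : term -> term -> Prop :=
| StepE V t s : root_e t s -> step_e (plug V t) (plug V s).

Inductive step (t s : term) : Type :=
| MStep of step_m t s
| EStep of step_e t s.

(* Reduction sequences are data, so that their steps can be counted. *)
Inductive steps : term -> term -> Type :=
| StepsRefl t : steps t t
| StepsCons t u s : step t u -> steps u s -> steps t s.

Fixpoint size_m t s (d : steps t s) : nat :=
  match d with
  | StepsRefl _ => 0
  | StepsCons _ _ _ (MStep _) d => (size_m d).+1
  | StepsCons _ _ _ (EStep _) d => size_m d
  end.

Fixpoint size_e t s (d : steps t s) : nat :=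
  match d with
  | StepsRefl _ => 0
  | StepsCons _ _ _ (MStep _) d => size_e d
  | StepsCons _ _ _ (EStep _) d => (size_e d).+1
  end.

Inductive normal : term -> Prop :=
| NormalLam t : normal (Lam t)
| NormalES t s : normal t -> normal s -> normal (ES t s).

(* Linear types, L ::= M -> N with M and N finite multisets of linear types.
   An inductive type cannot be nested inside {mset _}, so they are built as the
   trees over lists in which every list is sorted for a fixed total order (here
   the one induced by an injection into nat), i.e. one representative for each
   tree up to hereditary permutation. Only [arr], [arr_inj] and [lty_ind] below
   matter: they say that [lty] is freely generated by
   arr : {mset lty} -> {mset lty} -> lty. *)
Inductive raw : Type := RArr of seq raw & seq raw.

Fixpoint raw_code (r : raw) : GenTree.tree void :=
  let: RArr A B := r in
  GenTree.Node 0 [:: GenTree.Node 0 (map raw_code A);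
                     GenTree.Node 0 (map raw_code B)].

Fixpoint raw_decode (c : GenTree.tree void) : raw :=
  match c with
  | GenTree.Node _ [:: GenTree.Node _ a; GenTree.Node _ b] =>
      RArr (map raw_decode a) (map raw_decode b)
  | _ => RArr [::] [::]
  end.

Fixpoint all_prop (P : raw -> Prop) (A : seq raw) : Prop :=
  if A is r :: A then P r /\ all_prop P A else True.

Lemma raw_nested_ind (P : raw -> Prop) :
  (forall A B, all_prop P A -> all_prop P B -> P (RArr A B)) -> forall r, P r.
Proof.
move=> PA; fix IH 1 => -[A B]; apply: PA.
- by elim: A => //= r A IHA; split.
- by elim: B => //= r B IHB; split.
Qed.

Lemma raw_codeK : cancel raw_code raw_decode.
Proof.
elim/raw_nested_ind=> A B /= hA hB.
suff H C : all_prop (fun r => raw_decode (raw_code r) = r) C ->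
    map raw_decode (map raw_code C) = C by rewrite !H.
by elim: C => //= r C IH [-> /IH ->].
Qed.

HB.instance Definition _ := Countable.copy raw (can_type raw_codeK).

Definition raw_le (r r' : raw) : bool := choice.pickle r <= choice.pickle r'.

Lemma raw_le_total : total raw_le.
Proof. by move=> r r'; exact: leq_total. Qed.

Lemma raw_le_trans : transitive raw_le.
Proof. by move=> r r' r''; exact: leq_trans. Qed.

Lemma raw_le_anti : antisymmetric raw_le.
Proof. by move=> r r' /anti_leq /(pcan_inj choice.pickleK). Qed.

Fixpoint canonical (r : raw) : bool :=
  let: RArr A B := r in
  [&& sorted raw_le A, all canonical A, sorted raw_le B & all canonical B].

Record lty : Type := Lty { lty_raw : raw; _ : canonical lty_raw }.

HB.instance Definition _ := [isSub for lty_raw].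
HB.instance Definition _ := [Countable of lty by <:].

Notation mty := {mset lty}%mset.

Definition sorted_raw (M : mty) : seq raw := sort raw_le (map lty_raw M).

Lemma sorted_rawP M : sorted raw_le (sorted_raw M) && all canonical (sorted_raw M).
Proof.
rewrite sort_sorted ?all_sort; last exact: raw_le_total.
by apply/allP=> _ /mapP[L _ ->]; exact: valP L.
Qed.

Lemma sorted_raw_inj : injective sorted_raw.
Proof.
move=> M N eqMN; rewrite -(seq_mset_id M) -(seq_mset_id N).
apply/eq_seq_msetP/(perm_map_inj (val_inj : injective lty_raw)).
by rewrite -(perm_sort raw_le) -[X in perm_eq X _]/(sorted_raw M) eqMN perm_sort.
Qed.

Lemma arr_subproof (M N : mty) : canonical (RArr (sorted_raw M) (sorted_raw N)).
Proof. by have /= := sorted_rawP M; have := sorted_rawP N => -> /andP[-> ->]. Qed.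

Definition arr (M N : mty) : lty := Lty (arr_subproof M N).

Lemma arr_inj M N M' N' : arr M N = arr M' N' -> M = M' /\ N = N'.
Proof. by case=> /sorted_raw_inj -> /sorted_raw_inj ->. Qed.

Lemma sorted_raw_surj A : sorted raw_le A -> all canonical A ->
  exists2 M : mty, sorted_raw M = A & perm_eq (map lty_raw M) A.
Proof.
move=> sA cA.
have [s sE] : exists s : seq lty, map lty_raw s = A.
  elim: A cA {sA} => [|r A IH] /=; first by exists [::].
  by case/andP=> cr /IH[s <-]; exists (Lty cr :: s).
have pA : perm_eq (map lty_raw (seq_mset s)) A.
  by rewrite -sE; apply: perm_map; exact: perm_eq_seq_mset.
exists (seq_mset s) => //; apply: (sorted_eq raw_le_trans raw_le_anti) => //.
  by apply: sort_sorted; exact: raw_le_total.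
by rewrite perm_sort.
Qed.

Lemma lty_ind (P : lty -> Prop) :
  (forall M N : mty, (forall L, L \in M -> P L) -> (forall L, L \in N -> P L) ->
    P (arr M N)) ->
  forall L, P L.
Proof.
move=> Parr [r cr]; elim/raw_nested_ind: r cr => A B hA hB cr.
have /and4P[sA cA sB cB] := cr.
have H C : all_prop (fun r => forall cr : canonical r, P (Lty cr)) C ->
    forall M : mty, perm_eq (map lty_raw M) C -> forall L, L \in M -> P L.
  move=> hC M pM L LM.
  have : lty_raw L \in C by rewrite -(perm_mem pM) map_f.
  clear LM.
  elim: C hC {pM} => //= c C IH [Pc hC]; rewrite inE.
  have [eLc _|_ /=] := eqVneq; last exact: IH.
  by case: L eLc {IH} => l cl /= elc; subst l; exact: Pc.
have [M eM pM] := sorted_raw_surj sA cA.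
have [N eN pN] := sorted_raw_surj sB cB.
have -> : Lty cr = arr M N by apply: val_inj; rewrite /= eM eN.
by apply: Parr; [exact: H hA _ pM | exact: H hB _ pN].
Qed.

(* Type contexts; the de Bruijn index x plays the role of the variable x, and
   dom G is the library's [finsupp G]. *)
Definition tctx : Type := {fsfun nat -> mty with mset0}.

Definition ctx0 : tctx := [fsfun].

Definition ctx1 (x : nat) (M : mty) : tctx := [fsfun ctx0 with x |-> M].

Definition ctx_add (G D : tctx) : tctx :=
  [fsfun x in (finsupp G `|` finsupp D)%fset => (G x `+` D x)%mset].

Lemma ctx_addE G D x : ctx_add G D x = (G x `+` D x)%mset.
Proof.
rewrite fsfunE in_fsetU; case: finsuppP => [_|//].
by case: finsuppP => [_|//]; rewrite mset0D.
Qed.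

(* The context "G, x : N" of the body of a binder for x: index 0 is x, and the
   index of any other variable is shifted by one. *)
Definition ctx_cons (N : mty) (G : tctx) : tctx :=
  [fsfun x in (0 |` [fset y.+1 | y in finsupp G])%fset =>
     if x is y.+1 then G y else N].

Lemma ctx_consE N G x : ctx_cons N G x = if x is y.+1 then G y else N.
Proof.
rewrite fsfunE; case: ifPn => //; case: x => [|y].
  by rewrite in_fsetU in_fset1.
rewrite in_fsetU in_fset1 /= => nG; rewrite fsfun_dflt //.
by apply: contra nG => yG; apply/imfsetP; exists y.
Qed.

(* [typed G m e t M] is G |-^(m,e) t : M for a multi type M, and
   [ltyped G m e t L] is G |-^(m,e) t : L for a linear type L. *)
Inductive typed : tctx -> nat -> nat -> term -> mty -> Prop :=
| TAx x M : typed (ctx1 x M) 0 1 (Var x) M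
| TApp G P m e m' e' t s M N :
    typed G m e t [mset arr M N]%mset -> typed P m' e' s M ->
    typed (ctx_add G P) (m + m' + 1) (e + e') (App t s) N
| TMany (J : finType) (P : J -> tctx) (m e : J -> nat) t (L : J -> lty) :
    (forall j, ltyped (P j) (m j) (e j) (Lam t) (L j)) ->
    typed (\big[ctx_add/ctx0]_(j : J) P j) (\sum_(j : J) m j) (\sum_(j : J) e j)
      (Lam t) (seq_mset [seq L j | j : J])
| TES G P m e m' e' t s M N :
    typed (ctx_cons N G) m e t M -> typed P m' e' s N ->
    typed (ctx_add G P) (m + m') (e + e') (ES t s) M
with ltyped : tctx -> nat -> nat -> term -> lty -> Prop :=
| TFun G m e t M N :
    typed (ctx_cons N G) m e t M -> ltyped G m e (Lam t) (arr N M).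

Definition tight (G : tctx) (M : mty) : Prop :=
  M = mset0 /\ finsupp G = fset0.

(* Main.v *)
(* Quantitative subject expansion: if [t] makes one multiplicative (resp.
   exponential) step to [u], then a derivation for [u] with indices (m,e) yields
   a derivation for [t] with the same context and type and indices (m+1,e)
   (resp. (m,e+1)). Evaluation contexts are weak, so a term plugged into one is
   typed exactly once. In an exponential step the substituted copy of the value
   thus carries a single multi type N', which is given back to the variable by
   an axiom of weight (0,1), while the derivations of the value for N' and for
   the type N of the remaining occurrences merge into one for N + N'. Normal
   terms have a tight derivation with indices (0,0). *)
Require Import Defs.
From HB Require Import structures.
From mathcomp Require Import all_boot finmap multiset.
From mathcomp Require Import zify.

Set Implicit Arguments.
Unset Strict Implicit.
Unset Printing Implicit Defensive.

(** * Algebra of type contexts *)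

Lemma ctx_addC : commutative ctx_add.
Proof. by move=> G D; apply/fsfunP=> x; rewrite !ctx_addE msetDC. Qed.

Lemma ctx_addA : associative ctx_add.
Proof. by move=> G D E; apply/fsfunP=> x; rewrite !ctx_addE msetDA. Qed.

Lemma ctx_add0l : left_id ctx0 ctx_add.
Proof. by move=> G; apply/fsfunP=> x; rewrite ctx_addE fsfun0E mset0D. Qed.

HB.instance Definition _ :=
  Monoid.isComLaw.Build tctx ctx0 ctx_add ctx_addA ctx_addC ctx_add0l.

Lemma ctx_add0r : right_id ctx0 ctx_add.
Proof. exact: Monoid.mulm1. Qed.

Lemma ctx1E x M y : ctx1 x M y = if y == x then M else mset0.
Proof. by rewrite fsfun_withE fsfun0E. Qed.

Lemma ctx_consD N N' G G' :
  ctx_cons (N `+` N')%mset (ctx_add G G') =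
  ctx_add (ctx_cons N G) (ctx_cons N' G').
Proof.
by apply/fsfunP=> -[|x]; rewrite ctx_addE !ctx_consE ?ctx_addE.
Qed.

Lemma ctx_cons0 : ctx_cons mset0 ctx0 = ctx0.
Proof. by apply/fsfunP=> -[|x]; rewrite ctx_consE !fsfun0E. Qed.

Lemma ctx_cons_ctx0 N : ctx_cons N ctx0 = ctx1 0 N.
Proof. by apply/fsfunP=> -[|x]; rewrite ctx_consE ctx1E ?fsfun0E. Qed.

Definition ctx_tail (G : tctx) : tctx :=
  [fsfun x in [fset y.-1 | y in finsupp G]%fset => G x.+1].

Lemma ctx_tailE (G : tctx) x : ctx_tail G x = G x.+1.
Proof.
rewrite fsfunE; case: ifPn => // nG; rewrite fsfun_dflt //.
by apply: contra nG => xG; apply/imfsetP; exists x.+1.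
Qed.

(** With [ctx_cons_inj], this solves the context equations that inversion produces under a
    binder. *)
Lemma ctx_consP (G : tctx) : G = ctx_cons (G 0) (ctx_tail G).
Proof. by apply/fsfunP=> -[|x]; rewrite ctx_consE ?ctx_tailE. Qed.

Lemma ctx_cons_inj N N' G G' :
  ctx_cons N G = ctx_cons N' G' -> N = N' /\ G = G'.
Proof.
move=> eqG; have ctxE x : ctx_cons N G x = ctx_cons N' G' x by rewrite eqG.
split; first by have := ctxE 0; rewrite !ctx_consE.
by apply/fsfunP=> x; have := ctxE x.+1; rewrite !ctx_consE.
Qed.

(** The counterpart of [shift] on contexts: the [d] indices from [c] on are fresh, hence carry
    [mset0]. *)
Definition ctx_shift (d c : nat) (G : tctx) : tctx :=
  [fsfun x in [fset (if c <= y then d + y else y)%N | y in finsupp G]%fset =>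
     if x < c then G x else if x < d + c then mset0 else G (x - d)].

Lemma ctx_shiftE d c G x :
  ctx_shift d c G x =
  if x < c then G x else if x < d + c then mset0 else G (x - d).
Proof.
rewrite fsfunE; case: ifPn => // nG; case: ltnP => [xc|cx].
  rewrite fsfun_dflt //; apply: contra nG => xG.
  by apply/imfsetP; exists x => //; rewrite leqNgt xc.
case: ltnP => // dcx; rewrite fsfun_dflt //; apply: contra nG => xG.
by apply/imfsetP; exists (x - d) => //; rewrite ifT; lia.
Qed.

Lemma ctx_shiftD d c G G' :
  ctx_shift d c (ctx_add G G') = ctx_add (ctx_shift d c G) (ctx_shift d c G').
Proof.
apply/fsfunP=> x; rewrite ctx_addE !ctx_shiftE.
by case: ifP => // _; last case: ifP => // _; rewrite ?mset0D ?ctx_addE.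
Qed.

Lemma ctx_shift_ctx0 d c : ctx_shift d c ctx0 = ctx0.
Proof. by apply/fsfunP=> x; rewrite ctx_shiftE !fsfun0E !if_same. Qed.

Lemma ctx_shift_ctx1 d c x M :
  ctx_shift d c (ctx1 x M) = ctx1 (if c <= x then d + x else x) M.
Proof.
apply/fsfunP=> y; rewrite ctx_shiftE !ctx1E.
case: (leqP c x) => cx; case: (ltnP y c) => yc; try case: (ltnP y (d + c)) => ydc;
  repeat (case: eqP => ? //); lia.
Qed.

Lemma ctx_shift_cons d c N G :
  ctx_shift d c.+1 (ctx_cons N G) = ctx_cons N (ctx_shift d c G).
Proof.
apply/fsfunP=> -[|x]; rewrite ctx_shiftE !ctx_consE //= ctx_shiftE ltnS.
rewrite addnS ltnS; case: ltnP => // cx; case: ltnP => // dcx.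
by rewrite subSn //; lia.
Qed.

Lemma ctx_shift10 G : ctx_shift 1 0 G = ctx_cons mset0 G.
Proof.
by apply/fsfunP=> -[|x]; rewrite ctx_shiftE ctx_consE //= subn1.
Qed.

Lemma ctx_shift_cons_inv d c N G H :
  ctx_cons N G = ctx_shift d c.+1 H ->
  exists2 H', H = ctx_cons N H' & G = ctx_shift d c H'.
Proof.
rewrite [H]ctx_consP ctx_shift_cons => /ctx_cons_inj[-> ->].
by exists (ctx_tail H).
Qed.

(* An argument that does not use the variable 0 leaves the whole multi type of
   that variable to the other premise. *)
Lemma ctx_add_cons_inv N G G1 G2 :
  ctx_cons N G = ctx_add G1 (ctx_shift 1 0 G2) ->
  exists2 G1', G1 = ctx_cons N G1' & G = ctx_add G1' G2.
Proof.
rewrite [G1]ctx_consP ctx_shift10 -ctx_consD msetD0 => /ctx_cons_inj[-> ->].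
by exists (ctx_tail G1).
Qed.

(** * Shifting of terms and evaluation contexts *)

Lemma shift0 c t : shift 0 c t = t.
Proof.
by elim: t c => /= [x|t IH|t IHt s IHs|t IHt s IHs] c; rewrite ?IH ?IHt ?IHs ?if_same.
Qed.

(** Crossing the outermost binder is split off, so that inductions on a context can apply their
    hypothesis to the term already shifted by one. *)
Lemma shiftSn d c t : shift d.+1 c t = shift d c (shift 1 c t).
Proof.
elim: t c => /= [x|t IH|t IHt s IHs|t IHt s IHs] c; rewrite -?IH -?IHt -?IHs //.
by congr Var; case: (leqP c x) => cx; case: ifP; lia.
Qed.

Lemma shift_ctx0 c V : shift_ctx 0 c V = V.
Proof.
by elim: V c => //= [V IH t|V IH t|t V IH|t V IH] c; rewrite IH shift0.
Qed.

Lemma shift_ctxSn d c V :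
  shift_ctx d.+1 c V = shift_ctx d c (shift_ctx 1 c V).
Proof.
by elim: V c => //= [V IH t|V IH t|t V IH|t V IH] c; rewrite -IH -shiftSn.
Qed.

Lemma shift_plug d c V t :
  shift d c (plug V t) = plug (shift_ctx d c V) (shift d (depth V + c) t).
Proof. by elim: V c => //= [V IH s|V IH s|s V IH|s V IH] c; rewrite IH ?addnS. Qed.

Lemma depth_shift_ctx d c V : depth (shift_ctx d c V) = depth V.
Proof. by elim: V c => //= V IH s c; rewrite IH. Qed.

(** The cutoff 1 fixes the plugged variable, so moving the context amounts to shifting the whole
    plugged term, to which [typed_shift_inv] applies. *)
Lemma plug_nc_shift_Var0 d V :
  plug_nc (shift_ctx d 1 V) (Var 0) = shift d 1 (plug_nc V (Var 0)).
Proof.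
rewrite /plug_nc shift_plug depth_shift_ctx /= addn0 ifN //; lia.
Qed.

(** * Inversion of typing and derivations for abstractions *)

Lemma typed_Var_inv G m e x M :
  typed G m e (Var x) M -> [/\ G = ctx1 x M, m = 0 & e = 1].
Proof. by move=> H; inversion H. Qed.

Lemma typed_App_inv G m e t s N :
  typed G m e (App t s) N ->
  exists G1 G2 m1 m2 e1 e2 M,
  [/\ typed G1 m1 e1 t [mset arr M N]%mset, typed G2 m2 e2 s M,
      G = ctx_add G1 G2, m = m1 + m2 + 1 & e = e1 + e2].
Proof.
by move=> H; inversion H; subst; exists G0, P, m0, m', e0, e', M.
Qed.

Lemma typed_ES_inv G m e t s M :
  typed G m e (ES t s) M ->
  exists G1 G2 m1 m2 e1 e2 N,
  [/\ typed (ctx_cons N G1) m1 e1 t M, typed G2 m2 e2 s N,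
      G = ctx_add G1 G2, m = m1 + m2 & e = e1 + e2].
Proof.
by move=> H; inversion H; subst; exists G0, P, m0, m', e0, e', N.
Qed.

Lemma ltyped_inv G m e t L :
  ltyped G m e (Lam t) L ->
  exists M N, L = arr N M /\ typed (ctx_cons N G) m e t M.
Proof. by move=> H; inversion H; subst; exists M, N. Qed.

Lemma seq_mset_imageE (J : finType) (L : J -> lty) a :
  seq_mset [seq L j | j : J] a = \sum_(j : J | L j == a) 1.
Proof. by rewrite mset_seqE -sum1_count big_map big_enum_cond. Qed.

(** The many rule amounts to adding linear derivations one at a time to the empty one. This view
    lets later proofs go by induction on the term instead of mutual induction on derivations. *)
Lemma typed_Lam_ind t (Q : tctx -> nat -> nat -> mty -> Prop) :
  Q ctx0 0 0 mset0 ->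
  (forall G m e L G' m' e' M, ltyped G m e (Lam t) L -> Q G' m' e' M ->
    Q (ctx_add G G') (m + m') (e + e') (L +` M)%mset) ->
  forall G m e M, typed G m e (Lam t) M -> Q G m e M.
Proof.
move=> Q0 QD G m e M H; inversion H as [| |J P m' e' t' L HL|]; subst.
(* The context, both indices and the multi type now range over the same list [enum J], on which the
   induction runs. *)
rewrite /image_mem [index_enum J]unlock -enumT.
elim: (enum J) => [|j s IH].
  rewrite !big_nil /=; have -> // : seq_mset [::] = mset0 :> mty.
  by apply/msetP=> a; rewrite mset_seqE mset0E.
rewrite !big_cons /=.
have -> : seq_mset (L j :: map L s) = (L j +` seq_mset (map L s))%mset.
  by apply/msetP=> a; rewrite mset1DE !mset_seqE /= eq_sym.
exact: QD.
Qed.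

Lemma typed_Lam0 t : typed ctx0 0 0 (Lam t) mset0.
Proof.
have := @TMany void (fun=> ctx0) (fun=> 0) (fun=> 0) t (of_void _).
rewrite !big_pred0; try by case.
have -> : seq_mset [seq of_void lty j | j : void] = mset0.
  by apply/msetP=> a; rewrite seq_mset_imageE big_pred0 ?mset0E //; case.
by apply; case.
Qed.

Lemma typed_Lam1 G m e t L :
  ltyped G m e (Lam t) L -> typed G m e (Lam t) [mset L]%mset.
Proof.
move=> H.
have := @TMany unit (fun=> G) (fun=> m) (fun=> e) t (fun=> L) (fun=> H).
rewrite !(big_pred1 tt); try by case.
have -> // : seq_mset [seq L | _ : unit] = [mset L]%mset.
apply/msetP=> a; rewrite seq_mset_imageE msetnE eq_sym.
case: eqP => _; last by rewrite big_pred0.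
by rewrite (big_pred1 tt) //; case.
Qed.

(** Two families of premises for the same abstraction form one family over the disjoint union of
    their index sets. *)
Lemma typed_LamD G m e G' m' e' t M M' :
  typed G m e (Lam t) M -> typed G' m' e' (Lam t) M' ->
  typed (ctx_add G G') (m + m') (e + e') (Lam t) (M `+` M')%mset.
Proof.
move=> H H'; inversion H as [| |J P n f u L HL|]; subst.
inversion H' as [| |J' P' n' f' u' L' HL'|]; subst.
pose cat (A : Type) (g : J -> A) (g' : J' -> A) (j : J + J') :=
  match j with inl i => g i | inr i => g' i end.
have := @TMany (J + J')%type (cat _ P P') (cat _ n n') (cat _ f f') t (cat _ L L').
rewrite !big_sumType /=.
have -> : seq_mset [seq cat _ L L' j | j : (J + J')%type] =
    (seq_mset [seq L j | j : J] `+` seq_mset [seq L' j | j : J'])%mset.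
  by apply/msetP=> a; rewrite msetE2 !seq_mset_imageE big_sumType.
by apply; case.
Qed.

(** * Typing under shifting and plugging *)

Lemma typed_shift d c G m e t M :
  typed G m e t M -> typed (ctx_shift d c G) m e (shift d c t) M.
Proof.
elim: t c G m e M => [x|t IH|t IHt s IHs|t IHt s IHs] c G m e M /=.
- by move=> /typed_Var_inv[-> -> ->]; rewrite ctx_shift_ctx1; exact: TAx.
- move: G m e M; apply: typed_Lam_ind => [|G m e L G' m' e' M HL HM].
    by rewrite ctx_shift_ctx0; exact: typed_Lam0.
  rewrite ctx_shiftD; apply: typed_LamD HM; apply: typed_Lam1.
  have [N [N' [-> Ht]]] := ltyped_inv HL.
  by apply: TFun; rewrite -ctx_shift_cons; exact: IH.
- move=> /typed_App_inv[G1 [G2 [m1 [m2 [e1 [e2 [N [Ht Hs -> -> ->]]]]]]]].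
  by rewrite ctx_shiftD; apply: TApp (IHt _ _ _ _ _ Ht) (IHs _ _ _ _ _ Hs).
- move=> /typed_ES_inv[G1 [G2 [m1 [m2 [e1 [e2 [N [Ht Hs -> -> ->]]]]]]]].
  rewrite ctx_shiftD; apply: TES (IHs _ _ _ _ _ Hs).
  by rewrite -ctx_shift_cons; exact: IHt.
Qed.

(** The rules have no weakening: a shifted term does not use the skipped indices, so its context
    gives them [mset0] and is itself a shift. *)
Lemma typed_shift_inv d c G m e t M :
  typed G m e (shift d c t) M ->
  exists2 G', G = ctx_shift d c G' & typed G' m e t M.
Proof.
elim: t c G m e M => [x|t IH|t IHt s IHs|t IHt s IHs] c G m e M /=.
- move=> /typed_Var_inv[-> -> ->]; exists (ctx1 x M); last exact: TAx.
  by rewrite ctx_shift_ctx1.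
- move: G m e M; apply: typed_Lam_ind => [|G m e L G' m' e' M HL [H' -> HM]].
    by exists ctx0; [rewrite ctx_shift_ctx0 | exact: typed_Lam0].
  have [N [N' [-> /IH[H eqH Ht]]]] := ltyped_inv HL.
  have [H1 eqH1 ->] := ctx_shift_cons_inv eqH; rewrite {}eqH1 in Ht.
  exists (ctx_add H1 H'); first by rewrite ctx_shiftD.
  by apply: typed_LamD HM; apply: typed_Lam1; exact: TFun.
- move=> /typed_App_inv[G1 [G2 [m1 [m2 [e1 [e2 [N [Ht Hs -> -> ->]]]]]]]].
  have [H1 -> Ht1] := IHt _ _ _ _ _ Ht; have [H2 -> Hs2] := IHs _ _ _ _ _ Hs.
  by exists (ctx_add H1 H2); [rewrite ctx_shiftD | exact: TApp Ht1 Hs2].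
- move=> /typed_ES_inv[G1 [G2 [m1 [m2 [e1 [e2 [N [Ht Hs -> -> ->]]]]]]]].
  have [H eqH Ht1] := IHt _ _ _ _ _ Ht; have [H2 -> Hs2] := IHs _ _ _ _ _ Hs.
  have [H1 eqH1 ->] := ctx_shift_cons_inv eqH; rewrite {}eqH1 in Ht1.
  by exists (ctx_add H1 H2); [rewrite ctx_shiftD | exact: TES Ht1 Hs2].
Qed.

(** The hole is in weak position, so the derivation contains exactly one subderivation for the
    plugged term. It can be cut out and replaced by any other one with the same type [N]. *)
Lemma typed_plug_nc V G m e t M :
  typed G m e (plug_nc V t) M ->
  exists G1 G2 m1 m2 e1 e2 N,
  [/\ typed G2 m2 e2 t N, G = ctx_add G1 G2, m = m1 + m2, e = e1 + e2 &
      forall G3 m3 e3 s, typed G3 m3 e3 s N ->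
        typed (ctx_add G1 G3) (m1 + m3) (e1 + e3) (plug_nc V s) M].
Proof.
rewrite /plug_nc.
elim: V t G m e M => [|V IH r|V IH r|r V IH|r V IH] t G m e M /=.
- rewrite shift0 => Ht; exists ctx0, G, 0, m, 0, e, M.
  by split; rewrite ?ctx_add0l // => G3 m3 e3 s; rewrite shift0 ctx_add0l.
- move=> /typed_App_inv[G1 [G2 [m1 [m2 [e1 [e2 [N [HV Hr -> -> ->]]]]]]]].
  have [H1 [H2 [n1 [n2 [f1 [f2 [P [Ht -> -> -> HP]]]]]]]] := IH _ _ _ _ _ HV.
  exists (ctx_add H1 G2), H2, (n1 + m2 + 1), n2, (f1 + e2), f2, P.
  split=> // [|||G3 m3 e3 s /HP{}HP]; try lia; first exact: Monoid.mulmAC.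
  rewrite (_ : ctx_add _ _ = ctx_add (ctx_add H1 G3) G2); last exact: Monoid.mulmAC.
  rewrite (_ : _ + m3 = n1 + m3 + m2 + 1); last lia.
  by rewrite (addnAC f1); exact: TApp HP Hr.
- rewrite shiftSn => /typed_ES_inv[G1 [G2 [m1 [m2 [e1 [e2 [N [HV Hr -> -> ->]]]]]]]].
  have [H1 [H2 [n1 [n2 [f1 [f2 [P [Ht eqH -> -> HP]]]]]]]] := IH _ _ _ _ _ HV.
  (* The plugged term was shifted past this binder, so the type [N] of the bound variable comes
     entirely from the rest of the context. *)
  have [H2' eqH2 Ht'] := typed_shift_inv Ht; rewrite {H2 Ht}eqH2 in eqH.
  have [H1' eqH1 ->] := ctx_add_cons_inv eqH; rewrite {H1 eqH}eqH1 in HP.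
  exists (ctx_add H1' G2), H2', (n1 + m2), n2, (f1 + e2), f2, P.
  split=> // [|||G3 m3 e3 s Hs]; try lia; first exact: Monoid.mulmAC.
  rewrite (_ : ctx_add _ _ = ctx_add (ctx_add H1' G3) G2); last exact: Monoid.mulmAC.
  rewrite (addnAC n1) (addnAC f1) shiftSn; apply: TES Hr.
  (* Likewise the replacement adds only [mset0] to the bound variable. *)
  rewrite -[N]msetD0 ctx_consD -ctx_shift10.
  by apply: HP; exact: typed_shift.
- move=> /typed_App_inv[G1 [G2 [m1 [m2 [e1 [e2 [N [Hr HV -> -> ->]]]]]]]].
  have [H1 [H2 [n1 [n2 [f1 [f2 [P [Ht -> -> -> HP]]]]]]]] := IH _ _ _ _ _ HV.
  exists (ctx_add G1 H1), H2, (m1 + n1 + 1), n2, (e1 + f1), f2, P.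
  split=> // [|||G3 m3 e3 s /HP{}HP]; try lia; first by rewrite ctx_addA.
  rewrite -ctx_addA (_ : _ + m3 = m1 + (n1 + m3) + 1); last lia.
  by rewrite -(addnA e1); exact: TApp Hr HP.
- move=> /typed_ES_inv[G1 [G2 [m1 [m2 [e1 [e2 [N [Hr HV -> -> ->]]]]]]]].
  have [H1 [H2 [n1 [n2 [f1 [f2 [P [Ht -> -> -> HP]]]]]]]] := IH _ _ _ _ _ HV.
  exists (ctx_add G1 H1), H2, (m1 + n1), n2, (e1 + f1), f2, P.
  split=> // [|||G3 m3 e3 s /HP{}HP]; try lia; first by rewrite ctx_addA.
  by rewrite -ctx_addA -!addnA; exact: TES Hr HP.
Qed.

(** * Subject expansion for root steps *)

Lemma root_m_expansion t s G m e M :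
  root_m t s -> typed G m e s M -> typed G m.+1 e t M.
Proof.
case=> {t s} S t s; elim: S s G m e M => // [|S IH r] s G m e M /=.
  move=> _; rewrite shift0.
  move=> /typed_ES_inv[G1 [G2 [m1 [m2 [e1 [e2 [N [Ht Hs -> -> ->]]]]]]]].
  (* The body and the argument keep their derivations; the application rule accounts for the
     additional multiplicative unit. *)
  by rewrite -addn1; apply: TApp Hs; apply: typed_Lam1; exact: TFun.
rewrite shiftSn => subS.
move=> /typed_ES_inv[G1 [G2 [m1 [m2 [e1 [e2 [N [/(IH _ _ _ _ _ subS) H Hr -> -> ->]]]]]]]].
have [H1 [H2 [n1 [n2 [f1 [f2 [P [Ht Hs eqH eqm ->]]]]]]]] := typed_App_inv H.
(* The argument ignores the variable bound to [r], so the derivation of [r] can move entirely to the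
   function side. *)
have [H2' eqH2 Hs'] := typed_shift_inv Hs; rewrite {H2 Hs}eqH2 in eqH.
have [H1' eqH1 ->] := ctx_add_cons_inv eqH; rewrite {H1 eqH}eqH1 in Ht.
rewrite (_ : ctx_add _ _ = ctx_add (ctx_add H1' G2) H2'); last exact: Monoid.mulmAC.
rewrite (_ : (m1 + m2).+1 = n1 + m2 + n2 + 1); last lia.
by rewrite (addnAC f1); apply: TApp Hs'; exact: TES Ht Hr.
Qed.

(** The induction on [S] generalizes [V], because each substitution in [S] pushes [V] under one more
    binder. *)
Lemma root_e_expansion t s G m e M :
  root_e t s -> typed G m e s M -> typed G m e.+1 t M.
Proof.
case=> {t s} V S u; elim: S V G m e M => // [|S IH r] V G m e M.
  rewrite /= shift_ctx0 => _.
  move=> /typed_ES_inv[G1 [G2 [m1 [m2 [e1 [e2 [N [HV Hu -> -> ->]]]]]]]].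
  have [H1 [H2 [n1 [n2 [f1 [f2 [P [Hv eqH -> -> HP]]]]]]]] := typed_plug_nc HV.
  (* The copy does not use the variable being substituted, so [N] is the type of its remaining
     occurrences only. *)
  have [H2' eqH2 Hv'] := @typed_shift_inv 1 0 _ _ _ (Lam u) _ Hv; rewrite {H2 Hv}eqH2 in eqH.
  have [H1' eqH1 ->] := ctx_add_cons_inv eqH; rewrite {H1 eqH}eqH1 in HP.
  (* The variable regains the type [P] of the copy, which raises its type to the sum of [N] and [P];
     the axiom contributes the exponential unit. *)
  have := HP _ _ _ _ (TAx 0 P).
  rewrite -ctx_cons_ctx0 -ctx_consD ctx_add0r => HV'.
  have := TES HV' (typed_LamD Hu Hv'); rewrite (ctx_addC G2) ctx_addA.
  by congr typed; lia.
rewrite /= shift_ctxSn => subS.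
move=> /typed_ES_inv[G1 [G2 [m1 [m2 [e1 [e2 [N [/(IH _ _ _ _ _ subS) H Hr -> -> ->]]]]]]]].
rewrite plug_nc_shift_Var0 in H.
have [H1 [H2 [n1 [n2 [f1 [f2 [P [HV Hs eqH -> eqe]]]]]]]] := typed_ES_inv H.
have [H1' eqH1 HV'] := typed_shift_inv HV.
have [H3 eqH3 eqH1'] := ctx_shift_cons_inv eqH1.
rewrite eqH1' ctx_addC in eqH; rewrite eqH3 in HV'.
(* Now [V] is the side that ignores the variable bound to [r]: its type [N] is used up by the term
   [plug S (Lam u)], around which the substitution of [r] is rebuilt. *)
have [H2' eqH2 ->] := ctx_add_cons_inv eqH; rewrite eqH2 in Hs.
rewrite (_ : ctx_add _ _ = ctx_add H3 (ctx_add H2' G2)); last first.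
  by rewrite (ctx_addC H2') ctx_addA.
rewrite (_ : (e1 + e2).+1 = f1 + (f2 + e2)); last lia.
by rewrite -addnA; apply: TES HV' _; exact: TES Hs Hr.
Qed.

(** * Closure under evaluation contexts and the reduction sequence *)

Lemma typed_plug_mono V a b t s :
  (forall G m e M, typed G m e s M -> typed G (a + m) (b + e) t M) ->
  forall G m e M,
    typed G m e (plug V s) M -> typed G (a + m) (b + e) (plug V t) M.
Proof.
(* In each case exactly one premise contains the hole, so the increments [a] and [b] are counted
   once. *)
move=> Hts; elim: V => //= [V IH r|V IH r|r V IH|r V IH] G m e M.
- move=> /typed_App_inv[G1 [G2 [m1 [m2 [e1 [e2 [N [/IH HV Hr -> -> ->]]]]]]]].
  by rewrite !addnA; exact: TApp HV Hr.
- move=> /typed_ES_inv[G1 [G2 [m1 [m2 [e1 [e2 [N [/IH HV Hr -> -> ->]]]]]]]].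
  by rewrite !addnA; exact: TES HV Hr.
- move=> /typed_App_inv[G1 [G2 [m1 [m2 [e1 [e2 [N [Hr /IH HV -> -> ->]]]]]]]].
  by rewrite addnA (addnCA a) (addnCA b); exact: TApp Hr HV.
- move=> /typed_ES_inv[G1 [G2 [m1 [m2 [e1 [e2 [N [Hr /IH HV -> -> ->]]]]]]]].
  by rewrite (addnCA a) (addnCA b); exact: TES Hr HV.
Qed.

Lemma step_m_expansion t s G m e M :
  step_m t s -> typed G m e s M -> typed G m.+1 e t M.
Proof.
case=> V {}t {}s ts; apply: (@typed_plug_mono V 1 0) => {}G {}m {}e {}M.
exact: root_m_expansion.
Qed.

Lemma step_e_expansion t s G m e M :
  step_e t s -> typed G m e s M -> typed G m e.+1 t M.
Proof.
case=> V {}t {}s ts; apply: (@typed_plug_mono V 0 1) => {}G {}m {}e {}M.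
exact: root_e_expansion.
Qed.

(** Abstractions use the empty many rule. In a substitution, the body typed in the empty context
    demands [mset0] of its variable, which is the type that the normal argument has. *)
Lemma normal_typed t : normal t -> typed ctx0 0 0 t mset0.
Proof.
elim=> [u|u r _ Hu _ Hr]; first exact: typed_Lam0.
by rewrite -ctx_cons0 in Hu; have := TES Hu Hr; rewrite ctx_add0l.
Qed.

Theorem theorem4 (t s : term) (d : steps t s) :
  closed_term t -> normal s ->
  exists (G : tctx) (M : mty), typed G (size_m d) (size_e d) t M /\ tight G M.
Proof.
move=> _ Hs; exists ctx0, mset0; split; last by split=> //; exact: finsupp0.
(* Expansion preserves context and type, so both stay fixed from the normal form back to the initial
   term. *)
elim: d Hs => {t s} [t|t u s [tu|tu] d IH] /= => [|/IH|/IH].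
- exact: normal_typed.
- exact: step_m_expansion.
- exact: step_e_expansion.
Qed.
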